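(* Let $\nu^1,\dots,\nu^K\in\mathcal P_2(\mathbb R^d)$, $\lambda^1,\dots,\lambda^K>0$ with $\sum_k\lambda^k=1$, and $b=(b_1,\dots,b_M)\in\mathbb R_{>0}^M$ with $\sum_jb_j=1$. Then $Y=(y_1,\dots,y_M)\in\mathbb R^{dM}$ solves $$\inf_{Y\in\mathbb R^{dM}}\ \sum_{k=1}^K\lambda^kW_2^2\Big(\sum_{j=1}^Mb_j\delta_{y_j},\nu^k\Big)$$ if and only if it solves $$\inf\Big\{-\frac{\|Y\|_b^2}{2}\ :\ Y=\sum_k\lambda^kX^k,\ X^k=(x_1^k,\dots,x_M^k)\in\mathbb R^{dM},\ \sum_jb_j\delta_{x_j^k}\preceq_C\nu^k\ \ \forall k\Big\}.$$
   Context: $\mathcal P_2(\mathbb R^d)$ is the set of probability measures on $\mathbb R^d$ with finite second moment, $W_2$ is the 2-Wasserstein distance, $\|Y\|_b^2:=\sum_j|y_j|^2b_j$, and $\mu\preceq_C\nu$ (convex order) means $\int\varphi\,\mathrm d\mu\le\int\varphi\,\mathrm d\nu$ for all convex $\varphi:\mathbb R^d\to\mathbb R$. *)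

(* Defs.v *)
From HB Require Import structures.
From mathcomp Require Import all_boot all_order all_algebra.
From mathcomp Require Import all_classical all_reals all_analysis.

Set Implicit Arguments.
Unset Strict Implicit.
Unset Printing Implicit Defensive.

Import Order.TTheory GRing.Theory Num.Theory.
Import numFieldNormedType.Exports.

Local Open Scope classical_set_scope.
Local Open Scope ring_scope.

(* R^d with its Borel sigma-algebra; an alias of 'rV[R]_d, so the algebraic and
   topological structures of row vectors remain available on it. *)
Notation borel_rV R d := (g_sigma_algebraType (open : set (set 'rV[R]_d))).

(* Squared Euclidean norm; the library's `|x| on 'rV[R]_d is the sup norm. *)
Definition sqnorm (R : realType) (d : nat) (x : 'rV[R]_d) : R :=
  \sum_(i < d) x ord0 i ^+ 2.

Definition P2 (R : realType) (d : nat) : set (probability (borel_rV R d) R) :=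
  [set mu : probability (borel_rV R d) R | (\int[mu]_x (sqnorm x)%:E < +oo)%E].

Definition coupling (R : realType) (d : nat)
    (mu nu : {measure set (borel_rV R d) -> \bar R})
    : set (probability (borel_rV R d * borel_rV R d)%type R) :=
  [set pi | forall A : set (borel_rV R d), measurable A ->
     pushforward pi fst A = mu A /\ pushforward pi snd A = nu A].

Definition W2 (R : realType) (d : nat)
    (mu nu : {measure set (borel_rV R d) -> \bar R}) : \bar R :=
  (ereal_inf [set \int[pi]_z (sqnorm (z.1 - z.2))%:E
             | pi in coupling mu nu] `^ 2^-1)%E.

(* A convex phi is bounded below by an affine function, so its negative part is
   integrable as soon as first moments are finite: on P_2 the convention
   +oo - oo = -oo for the library integral never comes into play. *)
Definition convex_order (R : realType) (d : nat)
    (mu nu : {measure set (borel_rV R d) -> \bar R}) : Prop :=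
  forall phi : 'rV[R]_d -> R, convex_function [set: 'rV[R]_d] phi ->
    (\int[mu]_x (phi x)%:E <= \int[nu]_x (phi x)%:E)%E.

(* A point Y = (y_1, ..., y_M) of R^(dM) is the M x d matrix of rows y_j. *)
Section atomic_measure.
Context (R : realType) (d M : nat) (b : 'I_M -> {posnum R}) (Y : 'M[R]_(M, d)).

Definition atomic_measure (A : set (borel_rV R d)) : \bar R :=
  (\sum_(j < M) (b j)%:num%:E * \d_(row j Y : borel_rV R d) A)%E.

Let term_ge0 j (A : set (borel_rV R d)) :
  (0 <= (b j)%:num%:E * \d_(row j Y : borel_rV R d) A :> \bar R)%E.
Proof. by rewrite mule_ge0 ?lee_fin. Qed.

Let atomic_measure0 : atomic_measure set0 = 0%E.
Proof. by rewrite /atomic_measure big1// => j _; rewrite measure0 mule0. Qed.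

Let atomic_measure_ge0 A : (0 <= atomic_measure A)%E.
Proof. by apply: sume_ge0 => j _; exact: term_ge0. Qed.

Let atomic_measure_sigma_additive : semi_sigma_additive atomic_measure.
Proof.
move=> F mF tF mUF; rewrite [X in _ --> X](_ : _ =
    limn (fun n => (\sum_(0 <= i < n) atomic_measure (F i))%E)).
  by apply: is_cvg_ereal_nneg_natsum => k _; exact: atomic_measure_ge0.
rewrite nneseries_sum; last by move=> j k _; exact: term_ge0.
apply: eq_bigr => j _; rewrite nneseriesZl//; congr (_ * _)%E.
exact: (measure_semi_bigcup (\d_(row j Y : borel_rV R d))).
Qed.

HB.instance Definition _ := isMeasure.Build _ _ _ atomic_measure
  atomic_measure0 atomic_measure_ge0 atomic_measure_sigma_additive.

End atomic_measure.

Definition sqnormb (R : realType) (d M : nat) (b : 'I_M -> {posnum R})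
    (Y : 'M[R]_(M, d)) : R :=
  \sum_(j < M) sqnorm (row j Y) * (b j)%:num.

Definition minimizer (T : Type) (disp : Order.disp_t) (V : porderType disp)
    (D : set T) (F : T -> V) (y : T) : Prop :=
  D y /\ forall z, D z -> (F y <= F z)%O.

Definition barycenter_objective (R : realType) (d K M : nat)
    (nu : 'I_K -> probability (borel_rV R d) R) (lambda : 'I_K -> R)
    (b : 'I_M -> {posnum R}) (Y : 'M[R]_(M, d)) : \bar R :=
  (\sum_(k < K) (lambda k)%:E * W2 (atomic_measure b Y) (nu k) ^+ 2)%E.

Definition convex_order_feasible (R : realType) (d K M : nat)
    (nu : 'I_K -> probability (borel_rV R d) R) (lambda : 'I_K -> R)
    (b : 'I_M -> {posnum R}) : set 'M[R]_(M, d) :=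
  [set Y | exists X : 'I_K -> 'M[R]_(M, d),
     Y = \sum_(k < K) lambda k *: X k /\
     forall k, convex_order (atomic_measure b (X k)) (nu k)].

(* Main.v *)
Require Import Defs.
From mathcomp Require Import all_boot all_order all_algebra.
From mathcomp Require Import all_classical all_reals all_analysis.
From HB Require Import structures.
From mathcomp Require Import measurable_realfun ring lra.
Import Order.TTheory GRing.Theory Num.Theory.
Import numFieldNormedType.Exports.
Local Open Scope classical_set_scope.
Local Open Scope ring_scope.

(** Write <Y, X> = sum_j b_j (y_j . x_j), let m be the second moment of nu and
    let C(nu) be the set of those X with mu_X <=_C nu.  The theorem follows from
      W_2^2(mu_Y, nu) = |Y|_b^2 + m - 2 max {<Y, X> : X in C(nu)}            (1)
    since then the barycenter objective at Y is, up to a constant, the minimum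
    over the feasible Z of |Y|_b^2 - 2 <Y, Z> = |Y - Z|_b^2 - |Z|_b^2.

    In (1), ">=" holds because the conditional means X of the second coordinate
    given the first satisfy mu_X <=_C nu by Jensen's inequality.  For "<=",
    neither Strassen's theorem nor Kantorovich duality is needed.  Given X in
    C(nu), consider the maps s : R^d -> {1..M} and the vectors (nu(s = j))_j
    together with the transport cost of z |-> (y_(s z), z).  By the convex
    order, every linear functional takes at some s a value at most its value at
    the target ((b_j)_j, |Y|_b^2 + m - 2 <Y, X>): choose s z as the argmax of
    finitely many affine functions of z.  A greedy choice of such maps has
    averages converging to the target, and a small admixture of constant maps
    then makes the first marginal exactly mu_Y.  The maximum is attained as
    C(nu) is compact, being bounded and an intersection of closed
    half-spaces. *)

(** * Convex functions on row vectors *)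

Section dot_product.
Context {R : realType} {d : nat}.
Implicit Types x y z : 'rV[R]_d.

Definition dotp x y : R := \sum_(i < d) x ord0 i * y ord0 i.

Lemma dotpC x y : dotp x y = dotp y x.
Proof. by apply: eq_bigr => i _; rewrite mulrC. Qed.

Lemma dotpDr x y z : dotp x (y + z) = dotp x y + dotp x z.
Proof. by rewrite -big_split; apply: eq_bigr => i _; rewrite mxE mulrDr. Qed.

Lemma dotpZr a x y : dotp x (a *: y) = a * dotp x y.
Proof. by rewrite mulr_sumr; apply: eq_bigr => i _; rewrite mxE mulrCA. Qed.

Lemma dotpZl a x y : dotp (a *: x) y = a * dotp x y.
Proof. by rewrite dotpC dotpZr dotpC. Qed.

Lemma dotp0r x : dotp x 0 = 0.
Proof. by apply: big1 => i _; rewrite mxE mulr0. Qed.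

Lemma dotpBr x y z : dotp x (y - z) = dotp x y - dotp x z.
Proof. by rewrite -scaleN1r dotpDr dotpZr mulN1r. Qed.

Lemma dotp_sumr (I : Type) (s : seq I) (P : pred I) x (f : I -> 'rV[R]_d) :
  dotp x (\sum_(i <- s | P i) f i) = \sum_(i <- s | P i) dotp x (f i).
Proof.
elim/big_rec2 : _ => [|i a b _ <-]; first exact: dotp0r.
exact: dotpDr.
Qed.

Lemma dotp_delta i x : dotp (delta_mx 0 i) x = x ord0 i.
Proof.
rewrite /dotp (bigD1 i)//= mxE !eqxx mul1r big1 ?addr0// => j ji.
by rewrite mxE (negbTE ji) andbF mul0r.
Qed.

Lemma dotpxx x : dotp x x = sqnorm x.
Proof. by apply: eq_bigr => i _; rewrite expr2. Qed.

Lemma sqnormB x y : sqnorm (x - y) = sqnorm x - 2 * dotp x y + sqnorm y.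
Proof.
rewrite -!dotpxx dotpBr dotpC dotpBr [dotp (x - y) y]dotpC dotpBr.
by rewrite (dotpC y x); ring.
Qed.

Lemma sqnorm_ge0 x : 0 <= sqnorm x.
Proof. by apply: sumr_ge0 => i _; exact: sqr_ge0. Qed.

Lemma sqnorm_eq0 x : sqnorm x = 0 -> x = 0.
Proof.
move=> /eqP; rewrite psumr_eq0 => [/allP h|i _]; last exact: sqr_ge0.
apply/rowP => i; rewrite mxE.
by have := h i (mem_index_enum i); rewrite /= sqrf_eq0 => /eqP.
Qed.

(** Since |u| <= 1 + u^2, a finite second moment makes every coordinate integrable. *)
Lemma coord_sqnorm x i : `|x ord0 i| <= 1 + sqnorm x.
Proof.
apply: (@le_trans _ _ (1 + x ord0 i ^+ 2)).
  rewrite -real_normK ?num_real//; move: `|x ord0 i| => u; nra.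
rewrite lerD2l /sqnorm (bigD1 i)//= lerDl.
by apply: sumr_ge0 => j _; exact: sqr_ge0.
Qed.

End dot_product.

Section subgradient.
Context {R : realType} {d : nat}.
Implicit Types x h : 'rV[R]_d.

Lemma convex_functionP (f : 'rV[R]_d -> R) : convex_function setT f <->
  forall (t : R) x y, 0 <= t <= 1 ->
    f (t *: x + (1 - t) *: y) <= t * f x + (1 - t) * f y.
Proof.
split=> [cf t x y t01|cf t x y _ _].
  by have := cf (Itv01 (proj1 (andP t01)) (proj2 (andP t01))) x y
    (in_setT _) (in_setT _).
have t01 : 0 <= t%:num <= 1 by rewrite ge0 le1.
exact: (cf t%:num x y t01).
Qed.

Section one_step.
Variables (g : 'rV[R]_d -> R) (p : 'rV[R]_d).
Variable H : 'rV[R]_d -> Prop.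
Hypothesis H_conv : forall (t : R) x y, H x -> H y -> H (t *: x + (1 - t) *: y).
Hypothesis H0 : H 0.
Hypothesis g_conv : forall (t : R) x y, 0 <= t <= 1 ->
    g (t *: x + (1 - t) *: y) <= t * g x + (1 - t) * g y.
Hypothesis gp : forall h, H h -> dotp p h <= g h.

(** The extension step of Hahn-Banach: by convexity of [g], every difference quotient in direction
    [- e] is at most every one in direction [e], and the supremum of the former serves as slope
    along [e]. *)
Lemma subgradient_slope e : exists a, forall h s, H h ->
  dotp p h + a * s <= g (h + s *: e).
Proof.
have key h h' s r : H h -> H h' -> 0 < s -> 0 < r ->
    (dotp p h' - g (h' - r *: e)) / r <= (g (h + s *: e) - dotp p h) / s.
  move=> Hh Hh' s0 r0; rewrite ler_pdivrMr// mulrAC ler_pdivlMr//.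
  have rs0 : 0 < r + s by rewrite addr_gt0.
  (* With this weight the [e]-components of the two points cancel, so their convex combination lies
     in [H]. *)
  pose t := r / (r + s).
  have t01 : 0 <= t <= 1.
    by rewrite ler_pdivrMr// mul1r lerDl (ltW s0) divr_ge0 ?ltW.
  have tE : t * (r + s) = r by rewrite /t divfK// gt_eqF.
  have t1E : (1 - t) * (r + s) = s by rewrite mulrBl tE; ring.
  have := g_conv t (h + s *: e) (h' - r *: e) t01.
  rewrite (_ : t *: (h + s *: e) + _ = t *: h + (1 - t) *: h'); last first.
    rewrite !scalerDr scalerN !scalerA addrACA -scalerBl.
    suff -> : t * s - (1 - t) * r = 0 by rewrite scale0r addr0.
    rewrite -[X in t * X]t1E -[X in _ - _ * X]tE; ring.
  have := gp _ (H_conv t _ _ Hh Hh'); rewrite dotpDr !dotpZr => h1 h2.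
  have := ler_wpM2r (ltW rs0) (le_trans h1 h2).
  have E X Z : (t * X + (1 - t) * Z) * (r + s) = r * X + s * Z.
    by rewrite mulrDl (mulrAC t) (mulrAC (1 - t)) tE t1E.
  rewrite !E; lra.
pose S := [set (dotp p z.1 - g (z.1 - z.2 *: e)) / z.2
             | z in [set z : 'rV[R]_d * R | H z.1 /\ 0 < z.2]].
have S_sup : has_sup S.
  split; first by exists ((dotp p 0 - g (0 - 1 *: e)) / 1), (0, 1).
  exists ((g (0 + 1 *: e) - dotp p 0) / 1) => _ [[h r] /= [Hh r0] <-].
  exact: key.
exists (sup S) => h s Hh; have [s0|s0|->] := ltgtP s 0.
- have : (dotp p h - g (h - (- s) *: e)) / (- s) <= sup S.
    by apply: ub_le_sup; [case: S_sup|exists (h, - s); rewrite //= oppr_gt0].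
  rewrite ler_pdivrMr ?oppr_gt0// scaleNr opprK; lra.
- have : sup S <= (g (h + s *: e) - dotp p h) / s.
    apply: ge_sup; first by case: S_sup.
    by move=> _ [[h' r] /= [Hh' r0] <-]; exact: key.
  rewrite ler_pdivlMr//; lra.
- by rewrite mulr0 scale0r !addr0; exact: gp.
Qed.

End one_step.

(* Hahn-Banach one coordinate at a time. *)
Lemma subgradient (f : 'rV[R]_d -> R) x : convex_function setT f ->
  exists p, forall y, f x + dotp p (y - x) <= f y.
Proof.
move=> /convex_functionP cf; pose g h := f (x + h) - f x.
have g_conv (t : R) h h' : 0 <= t <= 1 ->
    g (t *: h + (1 - t) *: h') <= t * g h + (1 - t) * g h'.
  move=> t01; have := cf t (x + h) (x + h') t01; rewrite /g.
  rewrite (_ : t *: (x + h) + _ = x + (t *: h + (1 - t) *: h')).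
    by move: (f _) (f _) (f _) (f _) => *; lra.
  by rewrite !scalerDr addrACA -scalerDl subrKC scale1r.
(* Induction on [k], with the inequality required only for vectors supported on the first [k]
   coordinates; [k = d] is the claim. *)
suff /(_ d (leqnn d))[p hp] : forall k, (k <= d)%N -> exists p, forall h,
    (forall i : 'I_d, (k <= i)%N -> h ord0 i = 0) -> dotp p h <= g h.
  exists p => y; have := hp (y - x); rewrite /g subrKC => hy.
  by rewrite -lerBrDl hy// => i; rewrite leqNgt ltn_ord.
elim=> [_|k ih kd].
  exists 0 => h h0; have -> : h = 0 by apply/rowP => i; rewrite h0// mxE.
  by rewrite dotp0r /g addr0 subrr.
have [p hp] := ih (ltnW kd).
pose H h := forall i : 'I_d, (k <= i)%N -> h ord0 i = 0.
have H0 : H 0 by move=> i _; rewrite mxE.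
have H_conv (t : R) h h' : H h -> H h' -> H (t *: h + (1 - t) *: h').
  by move=> Hh Hh' i ki; rewrite !mxE Hh// Hh'// !mulr0 addr0.
pose e : 'rV[R]_d := delta_mx 0 (Ordinal kd).
have [a ha] := subgradient_slope g p H H_conv H0 g_conv hp e.
(* The correction makes the functional take the value [a] on [e], and it leaves the values on [H]
   unchanged because [e] is orthogonal to [H]. *)
exists (p + (a - dotp p e) *: e) => h Hh.
pose s := h ord0 (Ordinal kd); pose h' := h - s *: e.
have Hh' : H h'.
  move=> i; rewrite leq_eqVlt => /predU1P[ki|ki].
    have -> : i = Ordinal kd by exact: val_inj.
    by rewrite !mxE !eqxx mulr1 subrr.
  rewrite !mxE Hh// (_ : (i == _) = false) ?andbF ?mulr0 ?subrr//.
  by apply/negbTE; rewrite -val_eqE/= gtn_eqF.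
have := ha h' s Hh'; rewrite subrK; apply: le_trans.
rewrite dotpC dotpDr dotpZr (dotpC h e) dotp_delta -/s dotpBr dotpZr.
by rewrite (dotpC h p) mulrBl; move: (dotp _ _) (dotp _ _) => *; lra.
Qed.

End subgradient.

(** * Measurable selections and greedy averaging *)

Section selection.
Context {R : realType} {M : nat}.

(* Ties are broken towards the least index, to make the level sets explicit. *)
Definition is_argmax (f : 'I_M -> R) (j : 'I_M) : bool :=
  [forall i, f i <= f j] && [forall i : 'I_M, (i < j)%N ==> (f i < f j)].

Lemma is_argmax_uniq f i j : is_argmax f i -> is_argmax f j -> i = j.
Proof.
move=> /andP[/forallP fi /forallP li] /andP[/forallP fj /forallP lj].
apply/val_inj; case: (ltngtP i j) => // ij.
- by have := lj i; rewrite ij/= ltNge fi.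
- by have := li j; rewrite ij/= ltNge fj.
Qed.

Lemma is_argmax_ex f (j0 : 'I_M) : exists j, is_argmax f j.
Proof.
pose P j := [forall i, f i <= f j].
have [j1 Pj1] : exists j, P j.
  exists [arg max_(i > j0) f i]%O; apply/forallP => i.
  by case: arg_maxP => // j _; apply.
case: (@arg_minnP _ j1 P (fun j => nat_of_ord j) Pj1) => j Pj jmin.
exists j; apply/andP; split=> //; apply/forallP => i; apply/implyP => ij.
rewrite ltNge; apply/negP => fji.
suff /jmin : P i by rewrite leqNgt ij.
by apply/forallP => l; apply: le_trans fji; exact: (forallP Pj l).
Qed.

Definition argmax_sel (j0 : 'I_M) (f : 'I_M -> R) : 'I_M :=
  xchoose (is_argmax_ex f j0).

Lemma argmax_selP j0 f i : f i <= f (argmax_sel j0 f).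
Proof. by have /andP[/forallP] := xchooseP (is_argmax_ex f j0). Qed.

Lemma argmax_selE j0 f j : argmax_sel j0 f = j <-> is_argmax f j.
Proof.
have h := xchooseP (is_argmax_ex f j0).
by split=> [<-//|]; exact: is_argmax_uniq.
Qed.

End selection.

Definition measurable_sel {d} {T : measurableType d} {M} (s : T -> 'I_M) :=
  forall j, measurable (s @^-1` [set j]).

Section measurable_selection.
Context {d d'} {T : measurableType d} {T' : measurableType d'} {R : realType}.
Context {M : nat}.

Lemma measurable_le_set (f g : T -> R) : measurable_fun setT f ->
  measurable_fun setT g -> measurable [set z | f z <= g z].
Proof.
move=> mf mg.
have -> : [set z | f z <= g z] = (g \- f) @^-1` `[0, +oo[.
  by apply/seteqP; split=> z /=; rewrite in_itv/= andbT subr_ge0.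
by rewrite -[X in measurable X]setTI; exact: measurable_funB.
Qed.

Lemma measurable_lt_set (f g : T -> R) : measurable_fun setT f ->
  measurable_fun setT g -> measurable [set z | f z < g z].
Proof.
move=> mf mg.
have -> : [set z | f z < g z] = ~` [set z | g z <= f z].
  by apply/seteqP; split=> z /=; rewrite ltNge => /negP.
exact/measurableC/measurable_le_set.
Qed.

Lemma measurable_sel_cst (j : 'I_M) : measurable_sel (fun _ : T => j).
Proof. by move=> i; rewrite preimage_cst; case: ifP. Qed.

Lemma measurable_sel_argmax (j0 : 'I_M) (f : 'I_M -> T -> R) :
  (forall j, measurable_fun setT (f j)) ->
  measurable_sel (fun z => argmax_sel j0 (f ^~ z)).
Proof.
move=> mf j.
have -> : (fun z => argmax_sel j0 (f ^~ z)) @^-1` [set j] =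
    (\bigcap_(i in setT) [set z | f i z <= f j z]) `&`
    \bigcap_(i in [set i : 'I_M | (i < j)%N]) [set z | f i z < f j z].
  apply/seteqP; split=> z /=.
    move=> /argmax_selE/andP[/forallP h1 /forallP h2]; split=> i /=.
      by move=> _; exact: h1.
    by move=> ij; have := h2 i; rewrite ij.
  move=> [h1 h2]; apply/argmax_selE/andP; split; apply/forallP => i.
    exact: h1.
  by apply/implyP; exact: h2.
apply: measurableI; apply: fin_bigcap_measurable => // i _.
- exact: measurable_le_set.
- exact: measurable_lt_set.
Qed.

(** A preimage splits into finitely many pieces, one for each value of [s]. *)
Lemma measurable_fun_sel (s : T -> 'I_M) (f : 'I_M -> T -> T') :
  measurable_sel s -> (forall j, measurable_fun setT (f j)) ->
  measurable_fun setT (fun z => f (s z) z).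
Proof.
move=> ms mf _ B mB; rewrite setTI.
have -> : (fun z => f (s z) z) @^-1` B =
    \bigcup_(j in setT) ((s @^-1` [set j]) `&` (f j @^-1` B)).
  apply/seteqP; split=> [z Bz|z [j _ [/= <-]]//].
  by exists (s z).
apply: fin_bigcup_measurable => // j _; apply: measurableI; first exact: ms.
by rewrite -[X in measurable X]setTI; exact: mf.
Qed.

End measurable_selection.

Section selection_integral.
Context {d} {T : measurableType d} {R : realType} {M : nat}.
Variable nu : probability T R.
Implicit Types s : T -> 'I_M.

Definition mass_sel s j : R := fine (nu (s @^-1` [set j])).

End selection_integral.

(** * Greedy averages approaching a point that no linear functional strictly separates *)

Section herding.
Context {R : realType} {I : finType} {S : Type}.
Variables (P : S -> Prop) (v : S -> I -> R) (p : I -> R) (B : R).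
Hypothesis vB : forall s, P s -> \sum_i (v s i - p i) ^+ 2 <= B.
Hypothesis vp : forall w : I -> R,
  exists2 s, P s & \sum_i w i * (v s i - p i) <= 0.

(* The cross term in the expansion of the square is nonpositive by the choice
   of the next point, so the squared norm grows at most linearly in n. *)
Lemma herding_sqr n : exists2 s : nat -> S, forall k, P (s k) &
  \sum_i (\sum_(k < n) (v (s k) i - p i)) ^+ 2 <= n%:R * B.
Proof.
elim: n => [|n [s Ps sB]].
  have [s Ps _] := vp (fun=> 0); exists (fun=> s) => //.
  by rewrite mul0r big1// => i _; rewrite big_ord0 expr0n.
have [t Pt tB] := vp (fun i => \sum_(k < n) (v (s k) i - p i)).
exists (fun k => if (k < n)%N then s k else t) => [k|]; first by case: ifP.
have -> : \sum_i (\sum_(k < n.+1)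
      (v (if (k < n)%N then s k else t) i - p i)) ^+ 2 =
    \sum_i (\sum_(k < n) (v (s k) i - p i)) ^+ 2 +
    2 * \sum_i (\sum_(k < n) (v (s k) i - p i)) * (v t i - p i) +
    \sum_i (v t i - p i) ^+ 2.
  rewrite mulr_sumr -!big_split/=; apply: eq_bigr => i _.
  rewrite big_ord_recr/= ltnn.
  under eq_bigr do rewrite ltn_ord.
  by ring.
have := vB _ Pt; rewrite -natr1 mulrDl mul1r; lra.
Qed.

(** Dividing the sums of [herding_sqr] by [n] turns the bound [n * B] into [B / n], which is at most
    [e ^+ 2] once [n] exceeds [B / e ^+ 2]. *)
Lemma herding e : 0 < e -> exists n (s : nat -> S),
  [/\ (0 < n)%N, forall k, P (s k) &
      forall i, `|n%:R^-1 * \sum_(k < n) v (s k) i - p i| <= e].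
Proof.
move=> e0; pose n := (Num.truncn (B / e ^+ 2)).+1.
have nB : B <= n%:R * e ^+ 2.
  rewrite -ler_pdivrMr ?exprn_gt0//; exact/ltW/truncnS_gt.
have [s Ps sB] := herding_sqr n.
exists n, s; split=> // i.
have n0 : (0 : R) < n%:R by rewrite ltr0n.
have -> : n%:R^-1 * \sum_(k < n) v (s k) i - p i =
    n%:R^-1 * \sum_(k < n) (v (s k) i - p i).
  rewrite sumrB mulrBr sumr_const card_ord -[X in _ - _ * X]mulr_natl.
  by rewrite mulKf ?gt_eqF.
rewrite normrM gtr0_norm ?invr_gt0// mulrC ler_pdivrMr//.
have en0 : 0 <= e * n%:R by apply: mulr_ge0; exact: ltW.
rewrite -ler_sqr ?nnegrE// real_normK ?num_real//.
apply: le_trans (_ : n%:R * B <= _).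
  apply: le_trans sB; rewrite (bigD1 i)//= lerDl.
  by apply: sumr_ge0 => j _; exact: sqr_ge0.
have -> : (e * n%:R) ^+ 2 = n%:R * (n%:R * e ^+ 2) by ring.
by rewrite ler_wpM2l// ltW.
Qed.

End herding.

(** * Integration against Borel measures on row vectors *)

Lemma continuous_sumr {R : realType} (T : topologicalType) (I : Type)
    (s : seq I) (f : I -> T -> R) :
  (forall i, continuous (f i)) -> continuous (fun x => \sum_(i <- s) f i x).
Proof.
move=> cf; elim: s => [|i s ih] x.
  by under eq_fun do rewrite big_nil; exact: cvg_cst.
under eq_fun do rewrite big_cons.
by apply: cvgD; [exact: cf|exact: ih].
Qed.

Section borel_row_vectors.
Context {R : realType} {d : nat}.
Notation T := (borel_rV R d).

Lemma open_borel (A : set 'rV[R]_d) : open A -> measurable (A : set T).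
Proof. exact: sub_sigma_algebra. Qed.

Lemma measurable_borel_set1 (y : 'rV[R]_d) : measurable ([set y] : set T).
Proof.
rewrite -[X in measurable X]setCK; apply: measurableC.
apply: open_borel; apply: closed_openC.
exact: (accessible_closed_set1
  (hausdorff_accessible (@norm_hausdorff R 'rV[R]_d))).
Qed.

(** The rays []a, +oo[] generate the Borel sets of the line. Lower semicontinuity covers both
    continuous and convex functions. *)
Lemma lsc_measurable (f : 'rV[R]_d -> R) :
  (forall a, open [set x | a < f x]) -> measurable_fun setT (f : T -> R).
Proof.
move=> lsc _; apply: (measurability _ (RGenOInfty.measurableE R)) => //.
move=> /= _ [_ [a ->] <-]; rewrite setTI; apply: open_borel.
have -> : f @^-1` `]a, +oo[ = [set x | a < f x].
  by apply/seteqP; split=> x /=; rewrite in_itv/= andbT.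
exact: lsc.
Qed.

Lemma continuous_lsc (f : 'rV[R]_d -> R) a :
  continuous f -> open [set x | a < f x].
Proof.
move=> cf; apply: (@open_comp _ _ f [set x | a < x]); last exact: open_gt.
by move=> x _; exact: cf.
Qed.

Lemma measurable_coord (i : 'I_d) :
  measurable_fun setT (fun z : T => z ord0 i : R).
Proof.
apply: lsc_measurable => a.
exact: (continuous_lsc (fun z => z ord0 i)) (@coord_continuous R 1 d ord0 i).
Qed.

Lemma continuous_dotp (p : 'rV[R]_d) : continuous (dotp p).
Proof.
apply: (@continuous_sumr R 'rV[R]_d 'I_d (index_enum 'I_d)
  (fun i x => p ord0 i * x ord0 i)) => i x.
apply: continuousM; first exact: cst_continuous.
exact: coord_continuous.
Qed.

Lemma measurable_dotp (p : 'rV[R]_d) : measurable_fun setT (dotp p : T -> R).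
Proof.
by apply: lsc_measurable => a; apply: continuous_lsc; exact: continuous_dotp.
Qed.

Lemma measurable_sqnorm : measurable_fun setT (@sqnorm R d : T -> R).
Proof.
apply: measurable_sum => i.
by apply: measurable_funX; exact: measurable_coord.
Qed.

(** A subgradient at [x] gives an affine minorant touching [f] at [x]. Where [a < f x], this
    minorant stays above [a] near [x], so the superlevel sets are open. *)
Lemma convex_measurable (f : 'rV[R]_d -> R) :
  convex_function setT f -> measurable_fun setT (f : T -> R).
Proof.
move=> cf; apply: lsc_measurable => a; rewrite openE => x /= ax.
have [p fp] := subgradient f x cf.
pose g y := f x + dotp p (y - x).
have cg : continuous g.
  have -> : g = (fun y => dotp p y + (f x - dotp p x)).
    by apply/funext => y; rewrite /g dotpBr addrCA.
  move=> y; apply: continuousD; first exact: continuous_dotp.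
  exact: cst_continuous.
have : nbhs x [set y | a < g y].
  apply: open_nbhs_nbhs; split; first exact: continuous_lsc.
  by rewrite /= /g subrr dotp0r addr0.
by apply: filterS => y /= ay; exact: lt_le_trans ay (fp y).
Qed.

End borel_row_vectors.

Section measurable_cost.
Context {R : realType} {d : nat}.
Notation T := (borel_rV R d).

Lemma measurable_cost :
  measurable_fun setT (fun z : T * T => sqnorm (z.1 - z.2) : R).
Proof.
apply: measurable_sum => i; apply: measurable_funX.
have -> : (fun x : T * T => (x.1 - x.2) ord0 i) =
    (fun x : T * T => x.1 ord0 i - x.2 ord0 i).
  by apply/funext => x; rewrite !mxE.
apply: measurable_funB.
- exact: (measurableT_comp (measurable_coord i) measurable_fst).
- exact: (measurableT_comp (measurable_coord i) measurable_snd).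
Qed.

End measurable_cost.

Section atomic_measure_integral.
Context {R : realType} {d M : nat}.
Variables (b : 'I_M.+1 -> {posnum R}) (X : 'M[R]_(M.+1, d)).
Notation T := (borel_rV R d).
Notation mu := (atomic_measure b X).

Lemma ge0_integral_atomic (f : T -> R) : measurable_fun setT f ->
  (forall x, 0 <= f x) ->
  (\int[mu]_x (f x)%:E = (\sum_(j < M.+1) (b j)%:num * f (row j X))%:E)%E.
Proof.
move=> mf f0; have b0 j : 0 <= (b j)%:num by [].
(* [msum] takes a sequence of measures indexed by natural numbers, hence [inord]; only the indices
   below [M.+1] are summed. *)
pose m k : {measure set T -> \bar R} :=
  mscale (NngNum (b0 (inord k))) (\d_(row (inord k) X : T)).
transitivity (\int[msum m M.+1]_x (f x)%:E)%E.
  apply: eq_measure_integral => A mA _.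
  rewrite /= /msum /atomic_measure; apply: eq_bigr => j _.
  by rewrite /= /mscale inord_val.
rewrite ge0_integral_measure_sum//; last 2 first.
- by move=> x _; rewrite lee_fin.
- exact/measurable_EFinP.
rewrite -sumEFin; apply: eq_bigr => j _.
rewrite ge0_integral_mscale//; last 2 first.
- exact/measurable_EFinP.
- by move=> x _; rewrite lee_fin.
rewrite integral_dirac//; last exact/measurable_EFinP.
by rewrite diracT mul1e inord_val EFinM.
Qed.

(** Positive and negative parts both integrate to finite sums of reals, so their difference is well
    defined for every measurable [f]. *)
Lemma integral_atomic (f : T -> R) : measurable_fun setT f ->
  (\int[mu]_x (f x)%:E = (\sum_(j < M.+1) (b j)%:num * f (row j X))%:E)%E.
Proof.
move=> mf; rewrite integralE.
pose fp x := Num.max (f x) 0; pose fm x := Num.max (- f x) 0.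
have -> : ((fun x : T => (f x)%:E)^\+ = (fun x : T => (fp x)%:E))%E.
  by apply/funext => x; rewrite (funeposE, funenegE) EFin_max.
have -> : ((fun x : T => (f x)%:E)^\- = (fun x : T => (fm x)%:E))%E.
  by apply/funext => x; rewrite (funeposE, funenegE) EFin_max.
have mfp : measurable_fun setT fp by exact: measurable_maxr.
have mfm : measurable_fun setT fm.
  by apply: measurable_maxr => //; exact: measurable_funN.
rewrite !ge0_integral_atomic// => [|x|x]; [|by rewrite le_max lexx orbT..].
rewrite -EFinB; congr EFin; rewrite -sumrB; apply: eq_bigr => j _.
rewrite -mulrBr /fp /fm; congr (_ * _); move: (f _) => u.
by case: (leP u 0) => u0; case: (leP (- u) 0) => ?; lra.
Qed.

End atomic_measure_integral.

Section real_integrals.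
Context {d} {T : measurableType d} {R : realType}.
Variable mu : {measure set T -> \bar R}.

Lemma Rintegral_sum (I : Type) (s : seq I) (f : I -> T -> R) :
  (forall i, mu.-integrable setT (EFin \o f i)) ->
  \int[mu]_z (\sum_(i <- s) f i z) = \sum_(i <- s) \int[mu]_z f i z.
Proof.
move=> fi; elim: s => [|i s ih].
  rewrite big_nil /Rintegral; under eq_integral do rewrite big_nil.
  by rewrite integral0.
rewrite big_cons -ih -RintegralD//; last first.
  have -> : EFin \o (fun x => \sum_(j <- s) f j x) =
      (fun x => \sum_(j <- s) (EFin \o f j) x)%E.
    by apply/funext => x /=; rewrite sumEFin.
  exact: integrable_sum.
by apply: eq_Rintegral => x _; rewrite big_cons.
Qed.

Lemma integrable_sumr (I : Type) (s : seq I) (f : I -> T -> R) :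
  (forall i, mu.-integrable setT (EFin \o f i)) ->
  mu.-integrable setT (EFin \o (fun z => \sum_(i <- s) f i z)).
Proof.
move=> fi.
have -> : EFin \o (fun x => \sum_(j <- s) f j x) =
    (fun x => \sum_(j <- s) (EFin \o f j) x)%E.
  by apply/funext => x /=; rewrite sumEFin.
exact: integrable_sum.
Qed.

Lemma integrableDr (f g : T -> R) :
  mu.-integrable setT (EFin \o f) -> mu.-integrable setT (EFin \o g) ->
  mu.-integrable setT (EFin \o (fun z => f z + g z)).
Proof. by move=> fi gi; apply: integrableD fi gi. Qed.

Lemma integrableZr_fin a (f : T -> R) : mu.-integrable setT (EFin \o f) ->
  mu.-integrable setT (EFin \o (fun z => a * f z)).
Proof. by move=> fi; apply: integrableZl fi. Qed.

Lemma Rintegral_EFin (f : T -> R) : mu.-integrable setT (EFin \o f) ->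
  (\int[mu]_z (f z)%:E = (\int[mu]_z f z)%R%:E)%E.
Proof. by move=> fi; rewrite fineK//; exact: integrable_fin_num. Qed.

(** The positive parts are ordered like the functions and the negative parts in reverse. This serves
    for convex functions that may have integral +oo but lie above an integrable maximum of affine
    functions. *)
Lemma le_integral_bounded_below (f g : T -> R) :
  mu.-integrable setT (EFin \o g) -> measurable_fun setT f ->
  (forall z, g z <= f z) ->
  (\int[mu]_z (g z)%:E <= \int[mu]_z (f z)%:E)%E.
Proof.
move=> /measurable_int/measurable_EFinP mg mf gf.
have /measurable_EFinP mfE := mf.
have /measurable_EFinP mgE := mg.
rewrite integralE [leRHS]integralE; apply: leeB.
- apply: ge0_le_integral => //; try exact: measurable_funepos.
  by move=> x _; rewrite !funeposE ge_max !le_max lexx !orbT lee_fin gf.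
- apply: ge0_le_integral => //; try exact: measurable_funeneg.
  by move=> x _; rewrite !funenegE ge_max !le_max lexx !orbT leeN2 lee_fin gf.
Qed.

End real_integrals.

Section selection_integrals.
Context {d} {T : measurableType d} {R : realType} {M : nat}.
Variable nu : probability T R.
Implicit Types s : T -> 'I_M.

Lemma integrable_cstr (a : R) : nu.-integrable setT (EFin \o (fun _ : T => a)).
Proof. exact: finite_measure_integrable_cst. Qed.

Lemma Rintegral_cst1 (a : R) : \int[nu]_z (fun _ : T => a) z = a.
Proof.
rewrite Rintegral_cst//; suff -> : fine (nu setT) = 1 by rewrite mulr1.
exact: (congr1 fine (probability_setT nu)).
Qed.

Lemma integrable_indicr (A : set T) : measurable A ->
  nu.-integrable setT (EFin \o (\1_A : T -> R)).
Proof. exact: integrable_indic. Qed.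

(** The function is dominated by the finite sum of all the [|f j|]. *)
Lemma integrable_sel s (f : 'I_M -> T -> R) : measurable_sel s ->
  (forall j, nu.-integrable setT (EFin \o f j)) ->
  nu.-integrable setT (EFin \o (fun z => f (s z) z)).
Proof.
move=> ms fi.
have fai j : nu.-integrable setT (EFin \o (fun z => `|f j z|)).
  exact: (integrable_abse (fi j)).
have := integrable_sumr _ _ (index_enum 'I_M) _ fai.
apply: le_integrable => //.
  apply/measurable_EFinP; apply: measurable_fun_sel ms _ => j.
  by apply/measurable_EFinP; exact: measurable_int (fi j).
move=> z _ /=; rewrite lee_fin (ger0_norm (sumr_ge0 _ _))//.
by rewrite (bigD1 (s z))//= lerDl sumr_ge0.
Qed.

Lemma sum_indic_sel s (u : 'I_M -> R) z :
  \sum_j u j * \1_(s @^-1` [set j]) z = u (s z).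
Proof.
rewrite (bigD1 (s z))//= indicE mem_set// mulr1 big1 ?addr0// => j js.
by rewrite indicE memNset ?mulr0//= => sz; rewrite sz eqxx in js.
Qed.

Lemma Rintegral_sel_cst s (u : 'I_M -> R) : measurable_sel s ->
  \int[nu]_z u (s z) = \sum_j u j * mass_sel nu s j.
Proof.
move=> ms; under eq_Rintegral do rewrite -sum_indic_sel.
rewrite Rintegral_sum => [|j]; last exact/integrableZr_fin/integrable_indicr.
apply: eq_bigr => j _; rewrite RintegralZl//; last exact: integrable_indicr.
by rewrite /mass_sel /Rintegral integral_indic// setIT.
Qed.

End selection_integrals.

Section second_moment.
Context {R : realType} {d : nat}.
Notation T := (borel_rV R d).
Variable nu : probability T R.
Hypothesis nu2 : P2 nu.

Lemma integrable_sqnorm : nu.-integrable setT (EFin \o (@sqnorm R d : T -> R)).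
Proof.
apply/integrableP; split.
  by apply/measurable_EFinP; exact: measurable_sqnorm.
rewrite (eq_integral (fun x : T => (sqnorm x)%:E)) => [|x _]; first exact: nu2.
by rewrite /= ger0_norm// sqnorm_ge0.
Qed.

Lemma integrable_coord i : nu.-integrable setT (EFin \o (fun z : T => z ord0 i)).
Proof.
have := integrableDr _ _ _ (integrable_cstr nu 1) integrable_sqnorm.
apply: le_integrable => //.
  by apply/measurable_EFinP; exact: measurable_coord.
move=> z _ /=; rewrite lee_fin [leRHS]ger0_norm ?addr_ge0 ?sqnorm_ge0//.
exact: coord_sqnorm.
Qed.

Lemma integrable_affine c p :
  nu.-integrable setT (EFin \o (fun z : T => c + dotp p z)).
Proof.
apply: integrableDr; first exact: integrable_cstr.
by apply: integrable_sumr => i; apply/integrableZr_fin/integrable_coord.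
Qed.

End second_moment.

(** * The convex order through maxima of affine functions *)

Lemma continuous_affine_comp {R : realType} (T : topologicalType) (f : T -> R)
  (a c : R) : continuous f -> continuous (fun x => a * (c + f x)).
Proof.
move=> cf x; apply: (@continuousM R T (cst a) (fun x => c + f x)).
  exact: cst_continuous.
apply: continuousD; first exact: cst_continuous.
exact: cf.
Qed.

Section convex_order_affine.
Context {R : realType} {d M : nat}.
Notation T := (borel_rV R d).

(** The maximum is written as the value at the selected index, so that its integral is an integral
    along a measurable selection. *)
Definition max_affine (c : 'I_M.+1 -> R) (p : 'I_M.+1 -> 'rV[R]_d)
    (z : 'rV[R]_d) : R :=
  let f j := c j + dotp (p j) z in f (argmax_sel ord0 f).

Lemma max_affine_ge c p j z : c j + dotp (p j) z <= max_affine c p z.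
Proof. exact: (argmax_selP ord0 (fun j => c j + dotp (p j) z) j). Qed.

Lemma max_affine_convex c p : convex_function setT (max_affine c p).
Proof.
apply/convex_functionP => t x y /andP[t0 t1]; rewrite {1}/max_affine.
set j := argmax_sel _ _.
have := ler_wpM2l t0 (max_affine_ge c p j x).
have t1' : 0 <= 1 - t by rewrite subr_ge0.
have := ler_wpM2l t1' (max_affine_ge c p j y).
by rewrite dotpDr !dotpZr !mulrDr => h1 h2; lra.
Qed.

Lemma measurable_sel_affine c p : measurable_sel (fun z : T =>
  argmax_sel (ord0 : 'I_M.+1) (fun j => c j + dotp (p j) z : R)).
Proof.
apply: measurable_sel_argmax => j.
by apply: measurable_funD => //; exact: measurable_dotp.
Qed.

Lemma integrable_max_affine (nu : probability T R) c p : P2 nu ->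
  nu.-integrable setT (EFin \o (max_affine c p : T -> R)).
Proof.
move=> nu2; pose f j z := c j + dotp (p j) z.
apply: (integrable_sel nu (fun z => argmax_sel ord0 (f ^~ z)) f).
  exact: measurable_sel_affine.
by move=> j; exact: integrable_affine.
Qed.

(* The subgradients of phi at the finitely many atoms of mu_X give an affine
   maximum below phi with the same mu_X-integral. *)
Lemma convex_order_max_affine (b : 'I_M.+1 -> {posnum R})
    (X : 'M[R]_(M.+1, d)) (nu : probability T R) : P2 nu ->
  convex_order (atomic_measure b X) nu <->
  forall c p, \sum_j (b j)%:num * (c j + dotp (p j) (row j X)) <=
              \int[nu]_z max_affine c p z.
Proof.
move=> nu2; split=> [co c p|h phi cphi].
  have cm := max_affine_convex c p.
  have := co _ cm.
  rewrite integral_atomic; last exact: convex_measurable.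
  rewrite Rintegral_EFin ?lee_fin; last exact: integrable_max_affine.
  apply: le_trans; apply: ler_sum => j _.
  by rewrite ler_wpM2l// max_affine_ge.
have mphi := convex_measurable phi cphi.
rewrite integral_atomic//.
have [p pP] := choice (fun j => subgradient phi (row j X) cphi).
pose c j := phi (row j X) - dotp (p j) (row j X).
have cE j y : c j + dotp (p j) y = phi (row j X) + dotp (p j) (y - row j X).
  by rewrite /c dotpBr; move: (phi _) (dotp _ _) (dotp _ _) => *; ring.
apply: le_trans (_ : (\int[nu]_z (max_affine c p z)%:E <= _)%E); last first.
  apply: le_integral_bounded_below => //; first exact: integrable_max_affine.
  by move=> z; rewrite /max_affine cE.
rewrite Rintegral_EFin ?lee_fin; last exact: integrable_max_affine.
apply: le_trans (h c p); apply: ler_sum => j _.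
by rewrite cE subrr dotp0r addr0.
Qed.

Lemma convex_order_integral (b : 'I_M.+1 -> {posnum R})
    (X : 'M[R]_(M.+1, d)) (nu : probability T R) c p (g : T -> R) : P2 nu ->
  convex_order (atomic_measure b X) nu -> nu.-integrable setT (EFin \o g) ->
  (forall j z, c j + dotp (p j) z <= g z) ->
  \sum_j (b j)%:num * (c j + dotp (p j) (row j X)) <= \int[nu]_z g z.
Proof.
move=> nu2 /(convex_order_max_affine b X nu nu2) h gi cg.
apply: le_trans (h c p) _; apply: le_Rintegral => //.
  exact: integrable_max_affine.
by move=> z _; exact: cg.
Qed.

End convex_order_affine.

(** * Compactness of C(nu) and attainment of the maximum *)

Section convex_order_compact.
Context {R : realType} {d M : nat}.
Notation T := (borel_rV R d).
Variables (b : 'I_M.+1 -> {posnum R}) (nu : probability T R).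
Hypothesis nu2 : P2 nu.

Definition dotb (Y X : 'M[R]_(M.+1, d)) : R :=
  \sum_j (b j)%:num * dotp (row j Y) (row j X).

Notation below :=
  [set X : 'M[R]_(M.+1, d) | convex_order (atomic_measure b X) nu].

(** The convex order is tested against |z_i|, which lies above the affine function
    [Num.sg (X j i) * z_i] used at atom [j] and above the zero function used at the other atoms. *)
Lemma convex_order_coord_bound X j i : below X ->
  (b j)%:num * `|X j i| <= \int[nu]_z `|(z : 'rV[R]_d) ord0 i|.
Proof.
move=> coX; pose p l : 'rV[R]_d :=
  if l == j then Num.sg (X j i) *: delta_mx 0 i else 0.
have := convex_order_integral b X nu (fun=> 0) p
  (fun z => `|z ord0 i|) nu2 coX (integrable_abse (integrable_coord nu nu2 i)).
have -> : \sum_j0 (b j0)%:num * (0 + dotp (p j0) (row j0 X)) =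
    (b j)%:num * `|X j i|.
  rewrite (bigD1 j)//= /p eqxx add0r dotpZl dotp_delta mxE -normrEsg.
  rewrite big1 ?addr0// => l /negbTE ->.
  by rewrite dotpC dotp0r addr0 mulr0.
apply=> l z; rewrite add0r /p; case: ifP => _; last by rewrite dotpC dotp0r.
rewrite dotpZl dotp_delta; apply: le_trans (ler_norm _) _.
by rewrite normrM normr_sg ler_piMl//; case: (_ == _).
Qed.

(** Matrices are flattened to row vectors, where closed bounded sets are compact. *)
Notation below_vec := [set v : 'rV[R]_(M.+1 * d) | below (vec_mx v)].

Lemma continuous_dotp_vec_mx (p : 'rV[R]_d) j :
  continuous (fun v : 'rV[R]_(M.+1 * d) => dotp p (row j (vec_mx v))).
Proof.
apply: (@continuous_sumr R 'rV[R]_(M.+1 * d) 'I_d (index_enum 'I_d)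
  (fun i v => p ord0 i * row j (vec_mx v) ord0 i)) => i x.
apply: continuousM; first exact: cst_continuous.
have -> : (fun v : 'rV[R]_(M.+1 * d) => row j (vec_mx v) ord0 i) =
    (fun v => v ord0 (mxvec_index j i)) by apply/funext => v; rewrite !mxE.
exact: coord_continuous.
Qed.

Lemma compact_convex_order : compact below_vec.
Proof.
apply: bounded_closed_compact.
  (* The outer absolute value makes each bound visibly nonnegative, so the sum of all of them
     dominates every coordinate. *)
  pose B i j := `|\int[nu]_z `|(z : 'rV[R]_d) ord0 i| | / (b j)%:num.
  exists (\sum_i \sum_j B i j); split; first exact: num_real.
  move=> r /ltW Br v bv; apply: le_trans Br.
  rewrite [leLHS]/Num.Def.normr/= mx_normrE.
  apply/bigmax_leP; split=> [|[i0 k] _ /=].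
    by apply: sumr_ge0 => i _; apply: sumr_ge0 => j _; rewrite divr_ge0.
  rewrite (ord1 i0); case/mxvec_indexP: k => j i.
  have -> : v ord0 (mxvec_index j i) = vec_mx v j i by rewrite mxE.
  rewrite (bigD1 i)//= (bigD1 j)//= -addrA.
  apply: le_trans (_ : B i j <= _).
    rewrite ler_pdivlMr// mulrC; apply: le_trans (ler_norm _).
    exact: convex_order_coord_bound.
  rewrite lerDl addr_ge0//; first by apply: sumr_ge0 => l _; rewrite divr_ge0.
  by apply: sumr_ge0 => l _; apply: sumr_ge0 => m _; rewrite divr_ge0.
have -> : below_vec = \bigcap_(cp in setT) [set v : 'rV[R]_(M.+1 * d) |
    \sum_j (b j)%:num * (cp.1 j + dotp (cp.2 j) (row j (vec_mx v))) <=
    \int[nu]_z max_affine cp.1 cp.2 z].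
  apply/seteqP; split=> v /=.
    by move=> /(convex_order_max_affine _ _ _ nu2) h [c p] _; exact: h.
  move=> h; apply/(convex_order_max_affine _ _ _ nu2) => c p.
  exact: (h (c, p)).
apply: closed_bigI => -[c p] _ /=.
apply: (@preimage_closed _ _ (fun v : 'rV[R]_(M.+1 * d) =>
  \sum_j (b j)%:num * (c j + dotp (p j) (row j (vec_mx v))))
  [set x | x <= \int[nu]_z max_affine c p z]); last exact: closed_le.
move=> v _; apply: (@continuous_sumr R 'rV[R]_(M.+1 * d) 'I_M.+1 (index_enum _)
  (fun j v => (b j)%:num * (c j + dotp (p j) (row j (vec_mx v))))) => j x.
exact/continuous_affine_comp/continuous_dotp_vec_mx.
Qed.

Lemma convex_order_max_dotb (Y : 'M[R]_(M.+1, d)) : below !=set0 ->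
  exists2 X, below X & forall X', below X' -> dotb Y X' <= dotb Y X.
Proof.
move=> [X0 bX0].
have ne : below_vec !=set0 by exists (mxvec X0); rewrite /= mxvecK.
have cf : {within below_vec, continuous (fun v => dotb Y (vec_mx v))}.
  apply: continuous_subspaceT.
  have -> : (fun v => dotb Y (vec_mx v)) = (fun v => \sum_j (b j)%:num *
      (0 + dotp (row j Y) (row j (vec_mx v)))).
    by apply/funext => v; apply: eq_bigr => j _; rewrite add0r.
  apply: (@continuous_sumr R 'rV[R]_(M.+1 * d) 'I_M.+1 (index_enum _)
    (fun j v => (b j)%:num * (0 + dotp (row j Y) (row j (vec_mx v))))) => j x.
  exact/continuous_affine_comp/continuous_dotp_vec_mx.
have [v] := compact_EVT_max ne compact_convex_order cf.
rewrite inE => /= bv vmax; exists (vec_mx v) => // X' bX'.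
by have := vmax (mxvec X'); rewrite mxvecK; apply; rewrite inE /= mxvecK.
Qed.

End convex_order_compact.

(** * From points below nu to couplings *)

Section selection_coupling.
Context {R : realType} {d M : nat}.
Notation T := (borel_rV R d).
Variables (b : 'I_M.+1 -> {posnum R}) (nu : probability T R).
Variable Y : 'M[R]_(M.+1, d).

Definition graph_sel (s : T -> 'I_M.+1) (z : T) : T * T := (row (s z) Y, z).

Lemma measurable_graph_sel s : measurable_sel s ->
  measurable_fun setT (graph_sel s).
Proof.
move=> ms; apply: (measurable_fun_sel s (fun j z => (row j Y : T, z)) ms) => j.
by apply: measurable_fun_pair => //; exact: measurable_id.
Qed.

Lemma measurable_sel_preimage (s : T -> 'I_M.+1) (P : set 'I_M.+1) :
  measurable_sel s -> measurable (s @^-1` P).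
Proof.
move=> ms; have -> : s @^-1` P = \bigcup_(j in P) s @^-1` [set j].
  by apply/seteqP; split=> [z Pz|z [j Pj /= ->]//]; exists (s z).
by apply: fin_bigcup_measurable => // j _; exact: ms.
Qed.

Lemma nu_sel_row (s : T -> 'I_M.+1) (A : set T) : measurable_sel s ->
  nu ((fun z => row (s z) Y : T) @^-1` A) =
  (\sum_j mass_sel nu s j * \1_A (row j Y : T))%:E.
Proof.
move=> ms; have mA := measurable_sel_preimage s (fun j => A (row j Y)) ms.
have -> : \sum_j mass_sel nu s j * \1_A (row j Y : T) =
    \int[nu]_z (\1_A (row (s z) Y : T)).
  rewrite (Rintegral_sel_cst nu s (fun j => \1_A (row j Y : T)))//.
  by apply: eq_bigr => j _; rewrite mulrC.
rewrite -Rintegral_EFin; last exact: (integrable_indicr nu _ mA).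
by rewrite -[X in nu X]setIT -integral_indic.
Qed.

(** The coupling is the mixture, with weights [w], of the images of [nu] under the maps
    [graph_sel (s k)]. Each image has second marginal [nu], and the prescribed average masses turn
    the mixed first marginal into mu_Y. *)
Lemma selection_coupling N (w : nat -> R) (s : nat -> T -> 'I_M.+1) :
  (forall k, 0 <= w k) -> (forall k, measurable_sel (s k)) ->
  \sum_(k < N) w k = 1 ->
  (forall j, \sum_(k < N) w k * mass_sel nu (s k) j = (b j)%:num) ->
  exists2 pi : probability (T * T)%type R,
    coupling (atomic_measure b Y) nu pi &
    forall f : T * T -> \bar R, measurable_fun setT f ->
    (forall z, 0 <= f z)%E ->
    (\int[pi]_z f z = \sum_(k < N) (w k)%:E * \int[nu]_z f (graph_sel (s k) z))%E.
Proof.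
move=> w0 ms w1 wb; have mg k := measurable_graph_sel (s k) (ms k).
pose g k : {measure set (T * T) -> \bar R} := pushforward nu (graph_sel (s k)).
pose m : {measure set (T * T) -> \bar R}^nat :=
  fun k => mscale (NngNum (w0 k)) (g mg k).
have mE A : msum m N A = (\sum_(k < N) (w k)%:E * nu (graph_sel (s k) @^-1` A))%E.
  by [].
have m1 : msum m N setT = 1%E.
  rewrite mE -w1 -sumEFin; apply: eq_bigr => k _.
  by rewrite preimage_setT probability_setT mule1.
pose pi : probability (T * T)%type R :=
  HB.pack (msum m N) (Measure_isProbability.Build _ _ _ (msum m N) m1).
exists pi => [A mA|f mf f0].
  split.
  - rewrite /pushforward -[LHS]/(msum m N _) mE.
    transitivity (\sum_(k < N) (w k * \sum_j mass_sel nu (s k) j *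
        \1_A (row j Y : T))%:E)%E.
      by apply: eq_bigr => k _; rewrite EFinM -nu_sel_row.
    rewrite sumEFin /= /atomic_measure.
    transitivity (\sum_j ((b j)%:num * \1_A (row j Y : T))%:E)%E; last first.
      by apply: eq_bigr => j _; rewrite EFinM.
    rewrite sumEFin; congr EFin.
    under eq_bigr do rewrite mulr_sumr.
    rewrite exchange_big; apply: eq_bigr => j _.
    by rewrite -wb mulr_suml; apply: eq_bigr => k _; rewrite mulrA.
  - rewrite /pushforward -[LHS]/(msum m N _) mE.
    have nuA : nu A = (fine (nu A))%:E by rewrite fineK// fin_num_measure.
    transitivity (\sum_(k < N) (w k * fine (nu A))%:E)%E.
      by apply: eq_bigr => k _; rewrite EFinM -nuA.
    by rewrite sumEFin -mulr_suml w1 mul1r -nuA.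
rewrite -[LHS]/(\int[msum m N]_z f z)%E ge0_integral_measure_sum//.
apply: eq_bigr => k _; rewrite ge0_integral_mscale//.
by rewrite ge0_integral_pushforward.
Qed.

End selection_coupling.

Lemma big_option {R : nmodType} {J : finType} (F : option J -> R) :
  \sum_i F i = F None + \sum_j F (Some j).
Proof.
rewrite (bigD1 None)//=; congr (_ + _).
rewrite (reindex_omap Some id) => [|[i|]]//.
by apply: eq_bigl => j; rewrite /= eqxx.
Qed.

Section selection_cost.
Context {R : realType} {d M : nat}.
Notation T := (borel_rV R d).
Variables (b : 'I_M.+1 -> {posnum R}) (nu : probability T R).
Hypothesis b_sum : \sum_j (b j)%:num = 1.
Hypothesis nu2 : P2 nu.
Variable Y : 'M[R]_(M.+1, d).

Definition sel_cost (s : T -> 'I_M.+1) : R :=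
  \int[nu]_z sqnorm (row (s z) Y - z).

Definition moment2 : R := \int[nu]_z sqnorm (z : 'rV[R]_d).

Lemma integrable_cost1 j :
  nu.-integrable setT (EFin \o (fun z : T => sqnorm (row j Y - z))).
Proof.
have -> : (fun z : T => sqnorm (row j Y - z)) =
    (fun z : T => (sqnorm (row j Y) + dotp (- 2 *: row j Y) z) + sqnorm z).
  by apply/funext => z; rewrite sqnormB dotpZl mulNr.
by apply: integrableDr; [exact: integrable_affine|exact: integrable_sqnorm].
Qed.

Lemma integrable_sel_cost s : measurable_sel s ->
  nu.-integrable setT (EFin \o (fun z : T => sqnorm (row (s z) Y - z))).
Proof.
move=> ms; apply: (integrable_sel nu s (fun j z => sqnorm (row j Y - z)) ms).
exact: integrable_cost1.
Qed.

(** A bound on [sel_cost s] uniform in [s]: it serves the greedy averaging and controls the cost of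
    the constant maps. *)
Definition cost_bound : R := \sum_j \int[nu]_z sqnorm (row j Y - (z : 'rV[R]_d)).

Lemma sel_cost_ge0 s : 0 <= sel_cost s.
Proof. by apply: Rintegral_ge0 => z _; exact: sqnorm_ge0. Qed.

Lemma sel_cost_le s : measurable_sel s -> sel_cost s <= cost_bound.
Proof.
move=> ms; rewrite /cost_bound -Rintegral_sum; last exact: integrable_cost1.
apply: le_Rintegral => //; first exact: integrable_sel_cost.
  exact/integrable_sumr/integrable_cost1.
move=> z _; rewrite (bigD1 (s z))//= lerDl.
by apply: sumr_ge0 => j _; exact: sqnorm_ge0.
Qed.

Lemma sum_mass_sel (s : T -> 'I_M.+1) :
  measurable_sel s -> \sum_j mass_sel nu s j = 1.
Proof.
move=> ms; rewrite -[RHS](Rintegral_cst1 nu 1).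
rewrite (Rintegral_sel_cst nu s (fun=> 1) ms).
by apply: eq_bigr => j _; rewrite mul1r.
Qed.

Lemma mass_sel_ge0 (s : T -> 'I_M.+1) j : 0 <= mass_sel nu s j.
Proof. by rewrite fine_ge0. Qed.

Lemma mass_sel_le1 (s : T -> 'I_M.+1) j :
  measurable_sel s -> mass_sel nu s j <= 1.
Proof.
move=> ms; rewrite -(sum_mass_sel s ms) (bigD1 j)//= lerDl.
by apply: sumr_ge0 => i _; exact: mass_sel_ge0.
Qed.

Lemma mass_sel_const (i j : 'I_M.+1) : mass_sel nu (fun=> i) j = (i == j)%:R.
Proof.
have := Rintegral_sel_cst nu (fun=> i) (fun l => (l == j)%:R)
  (measurable_sel_cst i).
rewrite Rintegral_cst1 => ->; rewrite (bigD1 j)//= eqxx mul1r big1 ?addr0//.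
by move=> l /negbTE ->; rewrite mul0r.
Qed.

Variable X : 'M[R]_(M.+1, d).
Hypothesis coX : convex_order (atomic_measure b X) nu.

(** The target cost: the expression maximised over C(nu) in (1) is evaluated at the given [X]. *)
Let t : R := sqnormb b Y + moment2 - 2 * dotb b Y X.

(* The minimising selection maximises affine functions of z, up to the common
   term |z|^2, so the convex order bounds its integral by the barycenters X. *)
Lemma sel_separation (u : 'I_M.+1 -> R) (a : R) :
  exists2 s : T -> 'I_M.+1, measurable_sel s &
    a * (sel_cost s - t) + \sum_j u j * (mass_sel nu s j - (b j)%:num) <= 0.
Proof.
(* Expanding the square, [c j + dotp (p j) z] equals - a |y_j - z|^2 - u_j plus the common term a
   |z|^2; the sign of [a] is arbitrary. *)
pose c j := - u j - a * sqnorm (row j Y).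
pose p j := (2 * a) *: row j Y.
have ms : measurable_sel (fun z : T =>
    argmax_sel (ord0 : 'I_M.+1) (fun j => c j + dotp (p j) z : R)).
  exact: measurable_sel_affine.
set s : T -> 'I_M.+1 := fun z => _ in ms; exists s => //.
have := (convex_order_max_affine b X nu nu2).1 coX c p.
have -> : \int[nu]_z max_affine c p z =
    \int[nu]_z ((- a) * sqnorm (row (s z) Y - z) +
                (a * sqnorm (z : 'rV[R]_d) + - u (s z))).
  apply: eq_Rintegral => z _; rewrite /max_affine -/(s z) /c /p sqnormB dotpZl.
  by move: (sqnorm _) (sqnorm _) (dotp _ _) (u _) => *; ring.
have iu : nu.-integrable setT (EFin \o (fun z : T => - u (s z))).
  apply: (integrable_sel nu s (fun j _ => - u j) ms) => j.
  exact: integrable_cstr.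
have i2 : nu.-integrable setT (EFin \o (fun z : T => a * sqnorm z)).
  by apply/integrableZr_fin; exact: integrable_sqnorm.
rewrite RintegralD//; last 2 first.
- by apply: integrableZr_fin; exact: integrable_sel_cost.
- exact: integrableDr.
have isc := integrable_sel_cost s ms; have im := integrable_sqnorm nu nu2.
rewrite RintegralD// !RintegralZl//.
rewrite (Rintegral_sel_cst nu s (fun j => - u j) ms) -/(sel_cost s) -/moment2.
have -> : \sum_j (b j)%:num * (c j + dotp (p j) (row j X)) =
    - (\sum_j u j * (b j)%:num) - a * sqnormb b Y + 2 * a * dotb b Y X.
  rewrite /sqnormb /dotb !mulr_sumr -!sumrN -!big_split/=.
  by apply: eq_bigr => j _; rewrite /c /p dotpZl; ring.
have -> : \sum_j u j * (mass_sel nu s j - (b j)%:num) =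
    - (\sum_j - u j * mass_sel nu s j) - \sum_j u j * (b j)%:num.
  by rewrite -!sumrN -big_split/=; apply: eq_bigr => j _; ring.
rewrite /t; move: (sel_cost s) (\sum_j _) (\sum_j _) (sqnormb _ _) (dotb _ _ _).
by move=> *; lra.
Qed.

Lemma sel_herding e : 0 < e -> exists n (s : nat -> T -> 'I_M.+1),
  [/\ (0 < n)%N, forall k, measurable_sel (s k),
      `|n%:R^-1 * \sum_(k < n) sel_cost (s k) - t| <= e &
      forall j, `|n%:R^-1 * \sum_(k < n) mass_sel nu (s k) j - (b j)%:num| <= e].
Proof.
(* Each selection becomes a vector whose coordinate [None] is its cost and whose coordinates
   [Some j] are its masses. *)
pose v (s : T -> 'I_M.+1) i := if i is Some j then mass_sel nu s j else sel_cost s.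
pose p i := if i is Some j then (b j)%:num else t.
(* Costs lie between 0 and [cost_bound], masses between 0 and 1, which bounds the distance to the
   target. *)
pose C := (cost_bound + `|t|) ^+ 2 + \sum_j (1 + (b j)%:num) ^+ 2.
have sqC (x y z : R) : 0 <= x -> x <= z -> (x - y) ^+ 2 <= (z + `|y|) ^+ 2.
  move=> x0 xz; have ny := normr_ge0 y.
  have z0 : 0 <= z + `|y| by lra.
  rewrite -[leLHS]real_normK ?num_real// ler_sqr ?nnegrE//.
  by apply: le_trans (ler_normB _ _) _; rewrite ger0_norm// lerD2r.
have vC s : measurable_sel s -> \sum_i (v s i - p i) ^+ 2 <= C.
  move=> ms; rewrite big_option lerD//=.
    by apply: sqC; [exact: sel_cost_ge0|exact: sel_cost_le].
  apply: ler_sum => j _; rewrite -[in leRHS](@gtr0_norm _ (b j)%:num)//.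
  by apply: sqC; [exact: mass_sel_ge0|exact: mass_sel_le1].
have vp (w : option 'I_M.+1 -> R) : exists2 s, measurable_sel s &
    \sum_i w i * (v s i - p i) <= 0.
  have [s ms h] := sel_separation (fun j => w (Some j)) (w None).
  by exists s => //; rewrite big_option.
move=> /(herding measurable_sel v p C vC vp)[n [s [n0 ms h]]].
by exists n, s; split=> // [|j]; [exact: (h None)|exact: (h (Some j))].
Qed.

(** Greedy selections receive total weight 1 - h and constant maps total weight h. The constant maps
    restore the exact masses [b], and a small h keeps the extra cost below [e]. *)
Lemma near_optimal_coupling e : 0 < e ->
  exists2 pi : probability (T * T)%type R, coupling (atomic_measure b Y) nu pi &
    (\int[pi]_z (sqnorm (z.1 - z.2))%:E <=
      (sqnormb b Y + moment2 - 2 * dotb b Y X + e)%:E)%E.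
Proof.
move=> e0; rewrite -/t.
have C0 : 0 <= cost_bound.
  apply: le_trans (sel_cost_le _ (measurable_sel_cst ord0)).
  exact: sel_cost_ge0.
(* The final error is at most [h * D]: [h * cost_bound] from the constant maps and [h * (|t| + 1)]
   from the greedy average. Dividing by [e + D] also ensures [h <= 1]. *)
pose D := `|t| + 1 + cost_bound.
have D0 : 0 < D by rewrite /D; have := normr_ge0 t; lra.
pose h := e / (e + D).
have eD0 : 0 < e + D by exact: addr_gt0.
have h0 : 0 < h by exact: divr_gt0.
have h1 : h <= 1 by rewrite /h ler_pdivrMr// mul1r lerDl ltW.
have hD : h * D <= e.
  by rewrite /h mulrAC ler_pdivrMr// ler_wpM2l ?(ltW e0)// lerDr ltW.
(* [S^-1] is a positive lower bound of all the [b j], so the tolerance [h * S^-1] is at most [h]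
   times each of them. *)
pose S := \sum_j (b j)%:num^-1.
have bS j : (b j)%:num^-1 <= S.
  by rewrite /S (bigD1 j)//= lerDl; apply: sumr_ge0 => i _; rewrite invr_ge0.
have S0 : 0 < S by apply: lt_le_trans (bS ord0); rewrite invr_gt0.
have Sb j : S^-1 <= (b j)%:num.
  by rewrite -[leRHS]invrK lef_pV2 ?posrE ?invr_gt0.
have b1 j : (b j)%:num <= 1.
  by rewrite -b_sum (bigD1 j)//= lerDl; apply: sumr_ge0.
have d0 : 0 < h * S^-1 by rewrite mulr_gt0 ?invr_gt0.
have [n [s [n0 ms hcost hmass]]] := sel_herding _ d0.
pose beta j := n%:R^-1 * \sum_(k < n) mass_sel nu (s k) j.
have nR0 : (0 : R) < n%:R by rewrite ltr0n.
have beta1 : \sum_j beta j = 1.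
  rewrite -mulr_sumr exchange_big/= (eq_bigr (fun=> 1)) => [|k _].
    by rewrite sumr_const card_ord mulVf ?gt_eqF.
  exact: sum_mass_sel.
pose a := 1 - h.
have a0 : 0 <= a by rewrite subr_ge0.
pose c j := (b j)%:num - a * beta j.
have c0 j : 0 <= c j.
  (* Nonnegativity then follows from (1 - h)(1 + h) <= 1. *)
  have : beta j <= (b j)%:num + h * (b j)%:num.
    have := hmass j; rewrite ler_norml => /andP[_].
    have := ler_wpM2l (ltW h0) (Sb j); rewrite -/(beta j); lra.
  move=> /(ler_wpM2l a0); rewrite /c subr_ge0 => /le_trans; apply.
  have bj : 0 <= (b j)%:num by [].
  have := mulr_ge0 (mulr_ge0 (ltW h0) (ltW h0)) bj; rewrite /a.
  by move: (b j)%:num (h) => x y; lra.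
have c1 : \sum_j c j = h.
  by rewrite sumrB b_sum -mulr_sumr beta1 /a; lra.
(* The first [n] maps are the greedy selections with equal weights; the next [M.+1] are the constant
   maps, with weights [c]. *)
pose w k := if (k < n)%N then a / n%:R else c (inord (k - n)).
pose s' k := if (k < n)%N then s k else fun=> inord (k - n).
have split_sum (F : R -> (T -> 'I_M.+1) -> R) :
    \sum_(k < n + M.+1) F (w k) (s' k) =
    \sum_(k < n) F (a / n%:R) (s k) + \sum_j F (c j) (fun=> j).
  rewrite big_split_ord/=; congr (_ + _); apply: eq_bigr => k _.
    by rewrite /w /s' /= ltn_ord.
  by rewrite /w /s' /= ltnNge leq_addr/= addKn inord_val.
have [||||pi cpi piE] := selection_coupling b nu Y (n + M.+1) w s'.
- by move=> k; rewrite /w; case: ifP => _; [rewrite divr_ge0// ltW|exact: c0].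
- by move=> k; rewrite /s'; case: ifP => _; [exact: ms|exact: measurable_sel_cst].
- rewrite (split_sum (fun x _ => x)) c1 sumr_const card_ord.
  rewrite -[X in X + _]mulr_natr.
  by rewrite divfK ?gt_eqF// /a subrK.
- move=> j; rewrite (split_sum (fun x s => x * mass_sel nu s j)).
  rewrite -mulr_sumr -mulrA -/(beta j) (bigD1 j)//= mass_sel_const eqxx mulr1.
  rewrite big1 ?addr0 => [|i /negbTE ij]; first by rewrite /c; lra.
  by rewrite mass_sel_const ij mulr0.
exists pi => //.
rewrite piE; last 2 first.
- by apply/measurable_EFinP; exact: measurable_cost.
- by move=> z; rewrite lee_fin sqnorm_ge0.
have ms' k : measurable_sel (s' k).
  by rewrite /s'; case: ifP => _; [exact: ms|exact: measurable_sel_cst].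
rewrite (eq_bigr (fun k : 'I__ => (w k * sel_cost (s' k))%:E)); last first.
  by move=> k _; rewrite EFinM -Rintegral_EFin//; exact: integrable_sel_cost.
rewrite sumEFin lee_fin (split_sum (fun x s => x * sel_cost s)).
rewrite -mulr_sumr -mulrA.
move: hcost; rewrite ler_norml; set g := _ * \sum_(k < n) _ => /andP[_ hg].
have : \sum_j c j * sel_cost (fun=> j) <= h * cost_bound.
  rewrite -c1 mulr_suml; apply: ler_sum => j _; rewrite ler_wpM2l//.
  exact/sel_cost_le/measurable_sel_cst.
have S1 : S^-1 <= 1 by exact: le_trans (Sb ord0) (b1 ord0).
have hS : h * S^-1 <= h by rewrite ler_piMr// ltW.
have : a * g <= t + h * `|t| + h.
  apply: le_trans (ler_wpM2l a0 (_ : g <= t + h)) _; first lra.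
  have := ler_norm (- t); rewrite normrN => /(ler_wpM2l (ltW h0)).
  have := mulr_ge0 (ltW h0) (ltW h0); rewrite /a; lra.
move: hD; rewrite /D; move: (\sum_j _) (a * g) => *; lra.
Qed.

End selection_cost.

(** * From couplings to points below nu *)

Section coupling_integral.
Context {R : realType} {d : nat}.
Notation T := (borel_rV R d).
Variables (mu nu : {measure set T -> \bar R}) (pi : probability (T * T)%type R).
Hypothesis cpi : coupling mu nu pi.

Lemma ge0_integral_coupling_fst (f : T -> \bar R) : measurable_fun setT f ->
  (forall x, 0 <= f x)%E -> (\int[pi]_z f z.1 = \int[mu]_x f x)%E.
Proof.
move=> mf f0.
rewrite -[LHS](ge0_integral_pushforward measurable_fst pi measurableT mf)//.
by apply: eq_measure_integral => A mA _; exact: (cpi A mA).1.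
Qed.

Lemma ge0_integral_coupling_snd (f : T -> \bar R) : measurable_fun setT f ->
  (forall x, 0 <= f x)%E -> (\int[pi]_z f z.2 = \int[nu]_x f x)%E.
Proof.
move=> mf f0.
rewrite -[LHS](ge0_integral_pushforward measurable_snd pi measurableT mf)//.
by apply: eq_measure_integral => A mA _; exact: (cpi A mA).2.
Qed.

Lemma integrable_coupling_snd (f : T -> R) : nu.-integrable setT (EFin \o f) ->
  pi.-integrable setT (EFin \o (fun z : T * T => f z.2)).
Proof.
move=> /integrableP[mf fi]; apply/integrableP; split.
  exact: measurableT_comp mf measurable_snd.
rewrite (ge0_integral_coupling_snd (fun x => `|(EFin \o f) x|)%E)//.
exact: measurableT_comp.
Qed.

Lemma Rintegral_coupling_snd (f : T -> R) : nu.-integrable setT (EFin \o f) ->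
  \int[pi]_z f z.2 = \int[nu]_x f x.
Proof.
move=> fi; have mf := measurable_int nu fi.
have f2i := integrable_coupling_snd f fi.
congr fine.
apply: etrans (esym (integral_pushforward measurable_snd mf f2i measurableT)) _.
by apply: eq_measure_integral => A mA _; exact: (cpi A mA).2.
Qed.

End coupling_integral.

Section coupling_barycenter.
Context {R : realType} {d M : nat}.
Notation T := (borel_rV R d).
Variables (b : 'I_M.+1 -> {posnum R}) (nu : probability T R).
Hypothesis b_sum : \sum_j (b j)%:num = 1.
Hypothesis nu2 : P2 nu.
Variable Y : 'M[R]_(M.+1, d).

(** A null set for the first marginal. There [weight j] is set to [b j], so that the weights sum to
    1 everywhere. *)
Let off : set T := [set y | forall l, row l Y <> y].

Let atom_mass j : R := \sum_(l | row l Y == row j Y) (b l)%:num.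

(* The conditional probability of the index j given the first coordinate y:
   atoms sharing the location y split its mass proportionally to b. *)
Let weight j (y : T) : R :=
  (b j)%:num / atom_mass j * \1_[set row j Y : T] y + (b j)%:num * \1_off y.

Let measurable_off : measurable off.
Proof.
have -> : off = \bigcap_(l in setT) ~` [set row l Y : T].
  by apply/seteqP; split=> [y oy l _ /= yl|y oy l ly];
    [exact: (oy l)|exact: (oy l)].
apply: fin_bigcap_measurable => // l _; apply: measurableC.
exact: measurable_borel_set1.
Qed.

Let atom_mass_gt0 j : 0 < atom_mass j.
Proof.
rewrite /atom_mass (bigD1 j)//= ltr_wpDr//.
by apply: sumr_ge0.
Qed.

Let weight_ge0 j y : 0 <= weight j y.
Proof. by rewrite addr_ge0// mulr_ge0// divr_ge0// ltW. Qed.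

Let weight_row j l : weight j (row l Y) =
  (row l Y == row j Y)%:R * ((b j)%:num / atom_mass j).
Proof.
rewrite /weight !indicE [in X in _ + X]memNset ?mulr0 ?addr0; last first.
  by move=> /= /(_ l).
rewrite mulrC; congr (_%:R * _); congr nat_of_bool.
by apply/idP/eqP => [/set_mem|->]//; exact: mem_set.
Qed.

Let sum_weight y : \sum_j weight j y = 1.
Proof.
have [[l <-]|oy] := pselect (exists l, row l Y = y); last first.
  have offy : off y by move=> l ly; apply: oy; exists l.
  rewrite -b_sum; apply: eq_bigr => j _; rewrite /weight !indicE.
  rewrite memNset ?mulr0 ?add0r; last by move=> /= yj; exact: (offy j).
  by rewrite mem_set// mulr1.
have E j : row j Y == row l Y -> atom_mass j = atom_mass l.
  by move=> /eqP jl; apply: eq_bigl => i; rewrite jl.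
rewrite -[RHS](@divff _ (atom_mass l)) ?gt_eqF// {2}/atom_mass mulr_suml.
rewrite [RHS]big_mkcond; apply: eq_bigr => j _; rewrite weight_row eq_sym.
by case: ifP => [/E ->|_]; rewrite ?mul1r ?mul0r.
Qed.

Let weight_le1 j y : weight j y <= 1.
Proof.
by rewrite -(sum_weight y) (bigD1 j)//= lerDl sumr_ge0.
Qed.

Let measurable_weight j : measurable_fun setT (weight j).
Proof.
apply: measurable_funD; apply: measurable_funM => //.
  by apply: measurable_indic; exact: measurable_borel_set1.
Qed.

(** The atoms located at [row j Y] have total mass [atom_mass j], of which the index [j] receives
    the fraction [b j / atom_mass j]. *)
Let atomic_weight j : \sum_l (b l)%:num * weight j (row l Y) = (b j)%:num.
Proof.
rewrite -[RHS](@mulfVK _ (atom_mass j)) ?gt_eqF// mulrC mulr_suml.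
rewrite [RHS]big_mkcond; apply: eq_bigr => l _; rewrite weight_row.
by case: ifP => _; rewrite ?mul1r ?mul0r ?mulr0// mulrC.
Qed.

Variable pi : probability (T * T)%type R.
Hypothesis cpi : coupling (atomic_measure b Y) nu pi.

Let integrable_weighted j (g : T -> R) : nu.-integrable setT (EFin \o g) ->
  pi.-integrable setT (EFin \o (fun z : T * T => weight j z.1 * g z.2)).
Proof.
move=> gi; have g2i := integrable_coupling_snd _ _ _ cpi g gi.
apply: le_integrable g2i => //.
  apply/measurable_EFinP; apply: measurable_funM.
    exact: measurableT_comp (measurable_weight j) measurable_fst.
  apply: measurableT_comp measurable_snd.
  by apply/measurable_EFinP; exact: measurable_int gi.
move=> z _ /=; rewrite lee_fin normrM ger0_norm// ler_piMl//.
Qed.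

Let integrable_weighted_affine j c p : pi.-integrable setT
  (EFin \o (fun z : T * T => weight j z.1 * (c + dotp p z.2))).
Proof.
exact/(integrable_weighted j (fun z => c + dotp p z))/integrable_affine.
Qed.

(** This is [b j] times the conditional expectation of [g] of the second coordinate given the index
    [j]. *)
Let mean j (g : T -> R) : R := \int[pi]_z (weight j z.1 * g z.2).

Let meanD j f g : nu.-integrable setT (EFin \o f) ->
  nu.-integrable setT (EFin \o g) ->
  mean j (fun z => f z + g z) = mean j f + mean j g.
Proof.
move=> fi gi; rewrite -RintegralD//; try exact: integrable_weighted.
by apply: eq_Rintegral => z _; rewrite mulrDr.
Qed.

Let meanZ j a f : nu.-integrable setT (EFin \o f) ->
  mean j (fun z => a * f z) = a * mean j f.
Proof.
move=> fi; rewrite -RintegralZl//; last exact: integrable_weighted.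
by apply: eq_Rintegral => z _; rewrite mulrCA.
Qed.

Let mean_cst j a : mean j (fun=> a) = (b j)%:num * a.
Proof.
have -> : mean j (fun=> a) = mean j (fun=> a * 1) by rewrite mulr1.
rewrite (meanZ j a (fun=> 1)); last exact: integrable_cstr.
rewrite mulrC; congr (_ * _).
rewrite /mean; under eq_Rintegral do rewrite mulr1.
rewrite /Rintegral (ge0_integral_coupling_fst _ _ _ cpi (EFin \o weight j))//.
- by rewrite integral_atomic//= atomic_weight.
- exact/measurable_EFinP.
- by move=> x; rewrite lee_fin.
Qed.

Let X : 'M[R]_(M.+1, d) :=
  \matrix_(j, i) ((b j)%:num^-1 * mean j (fun z => z ord0 i)).

Let mean_dotp j p : mean j (dotp p) = (b j)%:num * dotp p (row j X).
Proof.
rewrite /dotp mulr_sumr.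
transitivity (\sum_i mean j (fun z => p ord0 i * z ord0 i)).
  rewrite -(Rintegral_sum pi _ _
    (fun i z => weight j z.1 * (p ord0 i * z.2 ord0 i))).
    by apply: eq_Rintegral => z _; rewrite mulr_sumr.
  move=> i; apply: (integrable_weighted j (fun z => p ord0 i * z ord0 i)).
  by apply: integrableZr_fin; exact: integrable_coord.
apply: eq_bigr => i _; rewrite meanZ; last exact: integrable_coord.
by rewrite !mxE mulrCA mulVKf// gt_eqF.
Qed.

Let mean_affine j c p :
  mean j (fun z => c + dotp p z) = (b j)%:num * (c + dotp p (row j X)).
Proof.
rewrite meanD ?mean_cst ?mean_dotp ?mulrDr//; first exact: integrable_cstr.
have := integrable_affine nu nu2 0 p.
by congr (is_true (integrable _ _ _)); apply/funext => z /=; rewrite add0r.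
Qed.

(** Jensen's inequality for a maximum of affine functions: each affine function is below the
    maximum, and the weights sum to 1 at every point. *)
Let convex_order_barycenter : convex_order (atomic_measure b X) nu.
Proof.
apply/(convex_order_max_affine _ _ _ nu2) => c p.
under eq_bigr do rewrite -mean_affine.
rewrite -(Rintegral_sum pi _ _
  (fun j z => weight j z.1 * (c j + dotp (p j) z.2)));
  last by move=> j; exact: integrable_weighted_affine.
have im := integrable_max_affine nu c p nu2.
rewrite -(Rintegral_coupling_snd _ _ _ cpi _ im); apply: le_Rintegral => //.
- apply: integrable_sumr => j.
  exact: integrable_weighted_affine.
- exact: (integrable_coupling_snd _ _ _ cpi _ im).
move=> z _; rewrite -[leRHS]mul1r -(sum_weight z.1) mulr_suml.
by apply: ler_sum => j _; rewrite ler_wpM2l// max_affine_ge.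
Qed.

Let off_null : pi (fst @^-1` off) = 0%E.
Proof.
apply: etrans (cpi _ measurable_off).1 _; apply: big1 => j _.
by rewrite diracE memNset ?mule0//= => /(_ j).
Qed.

(** Over the atoms this is the cost minus |z.2|^2, since only indices [j] with [row j Y = z.1] have
    nonzero weight. Each summand is a weight times an affine function of [z.2], which [mean_affine]
    integrates. *)
Let F (z : T * T) : R :=
  \sum_j weight j z.1 * (sqnorm (row j Y) + dotp (- 2 *: row j Y) z.2).

Let cost_on_atoms z : ~ off z.1 -> sqnorm (z.1 - z.2) = F z + sqnorm z.2.
Proof.
move=> noff; have [l lz] : exists l, row l Y = z.1.
  by apply: contrapT => h; apply: noff => l lz; apply: h; exists l.
have -> : F z = sqnorm z.1 + dotp (- 2 *: z.1) z.2.
  transitivity ((\sum_j weight j z.1) * (sqnorm z.1 + dotp (- 2 *: z.1) z.2)).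
    rewrite mulr_suml; apply: eq_bigr => j _.
    by rewrite -lz weight_row; case: eqP => [->//|_]; rewrite !mul0r.
  by rewrite sum_weight mul1r.
apply: etrans (@sqnormB R d z.1 z.2) _.
by rewrite dotpZl mulNr.
Qed.

Let integrable_F : pi.-integrable setT (EFin \o F).
Proof.
apply: integrable_sumr => j.
exact: integrable_weighted_affine.
Qed.

Let integral_F : \int[pi]_z F z = sqnormb b Y - 2 * dotb b Y X.
Proof.
rewrite Rintegral_sum => [|j]; last first.
  exact: integrable_weighted_affine.
rewrite /sqnormb /dotb mulr_sumr -sumrB; apply: eq_bigr => j _.
rewrite -/(mean j (fun z => sqnorm (row j Y) + dotp (- 2 *: row j Y) z)).
by rewrite mean_affine dotpZl; ring.
Qed.

(** The cost equals [F z + sqnorm z.2] outside the null set over [off]. The equality holds for every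
    coupling, and bounding [dotb b Y X] by its maximum gives >= in (1). *)
Lemma coupling_barycenter : exists2 X : 'M[R]_(M.+1, d),
  convex_order (atomic_measure b X) nu &
  (\int[pi]_z (sqnorm (z.1 - z.2))%:E =
    (sqnormb b Y + moment2 nu - 2 * dotb b Y X)%:E)%E.
Proof.
exists X; first exact: convex_order_barycenter.
have i2 := integrable_coupling_snd _ _ _ cpi _ (integrable_sqnorm nu nu2).
have iF2 := integrableDr _ _ _ integrable_F i2.
rewrite (ae_eq_integral (EFin \o (fun z => F z + sqnorm z.2)))//; last 3 first.
- by apply/measurable_EFinP; exact: measurable_cost.
- exact: measurable_int iF2.
- exists (fst @^-1` off); split.
  + by rewrite -[X in measurable X]setTI; exact: measurable_fst.
  + exact: off_null.
  + move=> z /= nz; apply: contrapT => noff; apply: nz => _.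
    by rewrite /= cost_on_atoms.
rewrite Rintegral_EFin// RintegralD// integral_F.
rewrite (Rintegral_coupling_snd _ _ _ cpi _ (integrable_sqnorm nu nu2)).
by rewrite -/(moment2 nu) addrAC.
Qed.

End coupling_barycenter.

(** * Barycenters *)

Section wasserstein_atomic.
Context {R : realType} {d M : nat}.
Notation T := (borel_rV R d).
Variables (b : 'I_M.+1 -> {posnum R}) (nu : probability T R).
Hypothesis b_sum : \sum_j (b j)%:num = 1.
Hypothesis nu2 : P2 nu.
Variable Y : 'M[R]_(M.+1, d).

(** Mixing the constant maps with weights [b] gives the product of mu_Y and [nu]. *)
Lemma coupling_nonempty : coupling (atomic_measure b Y) nu !=set0.
Proof.
have [||||pi cpi _] := selection_coupling b nu Y M.+1
    (fun k => (b (inord k))%:num) (fun k _ => inord k).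
- by [].
- by move=> k; exact: measurable_sel_cst.
- by rewrite -b_sum; apply: eq_bigr => k _; rewrite inord_val.
- move=> j; rewrite (bigD1 j)//= inord_val mass_sel_const eqxx mulr1.
  rewrite big1 ?addr0// => i ij.
  by rewrite inord_val mass_sel_const (negbTE ij) mulr0.
by exists pi.
Qed.

Lemma sqr_poweR_half (x : R) : 0 <= x -> ((x%:E `^ 2^-1) ^+ 2 = x%:E)%E.
Proof.
by move=> x0; rewrite poweR_EFin powR12_sqrt// -EFin_expe sqr_sqrtr.
Qed.

Lemma W2_atomic : exists X : 'M[R]_(M.+1, d),
  [/\ convex_order (atomic_measure b X) nu,
      (W2 (atomic_measure b Y) nu ^+ 2 =
        (sqnormb b Y + moment2 nu - 2 * dotb b Y X)%:E)%E &
      forall X', convex_order (atomic_measure b X') nu ->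
        dotb b Y X' <= dotb b Y X].
Proof.
have [pi0 cpi0] := coupling_nonempty.
(* The conditional means of some coupling show that C(nu) is nonempty, as attainment of the maximum
   requires. *)
have [X0 coX0 _] := coupling_barycenter b nu b_sum nu2 Y pi0 cpi0.
have [X coX Xmax] := convex_order_max_dotb b nu nu2 Y (ex_intro _ X0 coX0).
exists X; split=> //; rewrite /W2.
set S := [set _ | _ in _].
have infE : ereal_inf S = (sqnormb b Y + moment2 nu - 2 * dotb b Y X)%:E.
  apply/eqP; rewrite eq_le; apply/andP; split.
    apply/lee_addgt0Pr => e e0; rewrite -EFinD.
    have [pi cpi picost] := near_optimal_coupling b nu b_sum nu2 Y X coX e e0.
    by apply: le_trans picost; apply: ereal_inf_lbound; exists pi.
  apply: le_ereal_inf_tmp => _ [pi cpi <-].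
  have [X' coX' ->] := coupling_barycenter b nu b_sum nu2 Y pi cpi.
  by rewrite lee_fin lerD2l lerN2 ler_pM2l// Xmax.
(* Squaring undoes the square root in [W2] because the infimum is nonnegative. *)
rewrite infE; apply: sqr_poweR_half; rewrite -lee_fin -infE.
apply: le_ereal_inf_tmp => _ [pi _ <-].
by apply: integral_ge0 => z _; rewrite lee_fin sqnorm_ge0.
Qed.

End wasserstein_atomic.

Section weighted_norm.
Context {R : realType} {d M : nat}.
Variable b : 'I_M.+1 -> {posnum R}.
Implicit Types Y Z : 'M[R]_(M.+1, d).

Lemma dotbb Z : dotb b Z Z = sqnormb b Z.
Proof. by apply: eq_bigr => j _; rewrite dotpxx mulrC. Qed.

Lemma sqnormbB Y Z :
  sqnormb b (Y - Z) = sqnormb b Y - 2 * dotb b Y Z + sqnormb b Z.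
Proof.
rewrite /sqnormb /dotb mulr_sumr -sumrB -big_split/=; apply: eq_bigr => j _.
by rewrite linearB/= sqnormB; ring.
Qed.

Lemma sqnormb_ge0 Y : 0 <= sqnormb b Y.
Proof. by apply: sumr_ge0 => j _; rewrite mulr_ge0// sqnorm_ge0. Qed.

Lemma sqnormb_eq0 Y : sqnormb b Y <= 0 -> Y = 0.
Proof.
move=> Y0; have /eqP : sqnormb b Y = 0 by apply/eqP; rewrite eq_le Y0 sqnormb_ge0.
rewrite psumr_eq0 => [/allP h|j _]; last by rewrite mulr_ge0// sqnorm_ge0.
apply/row_matrixP => j; rewrite row0; apply: sqnorm_eq0.
have := h j (mem_index_enum j); rewrite /= mulf_eq0 => /orP[/eqP//|].
by rewrite gt_eqF.
Qed.

Lemma dotb_sum (I : finType) (w : I -> R) (X : I -> 'M[R]_(M.+1, d)) Y :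
  dotb b Y (\sum_k w k *: X k) = \sum_k w k * dotb b Y (X k).
Proof.
rewrite /dotb; under [RHS]eq_bigr do rewrite mulr_sumr.
rewrite exchange_big; apply: eq_bigr => j _ /=.
rewrite linear_sum/= dotp_sumr mulr_sumr; apply: eq_bigr => k _.
by rewrite linearZ/= dotpZr mulrCA.
Qed.

End weighted_norm.

Section barycenter.
Context {R : realType} {d K M : nat}.
Variables (nu : 'I_K -> probability (borel_rV R d) R) (lambda : 'I_K -> R).
Hypothesis nu2 : forall k, P2 (nu k).
Hypothesis lambda_gt0 : forall k, 0 < lambda k.
Hypothesis lambda_sum : \sum_k lambda k = 1.
Variable b : 'I_M.+1 -> {posnum R}.
Hypothesis b_sum : \sum_j (b j)%:num = 1.
Implicit Types Y Z : 'M[R]_(M.+1, d).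

Let C : R := \sum_k lambda k * moment2 (nu k).

Let sum_value Y (X : 'I_K -> 'M[R]_(M.+1, d)) :
  \sum_k lambda k * (sqnormb b Y + moment2 (nu k) - 2 * dotb b Y (X k)) =
  sqnormb b Y + C - 2 * dotb b Y (\sum_k lambda k *: X k).
Proof.
rewrite dotb_sum mulr_sumr -[X in X + C]mul1r -lambda_sum mulr_suml.
rewrite -big_split -sumrB; apply: eq_bigr => k _ /=; ring.
Qed.

(** For each [k] a maximiser in (1) is chosen; [Z] is their average with weights [lambda]. *)
Lemma barycenter_objective_attained Y :
  exists2 Z, convex_order_feasible nu lambda b Z &
    barycenter_objective nu lambda b Y = (sqnormb b Y + C - 2 * dotb b Y Z)%:E.
Proof.
have [X XP] := choice (fun k => W2_atomic b (nu k) b_sum (nu2 k) Y).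
exists (\sum_k lambda k *: X k).
  by exists X; split=> // k; have [] := XP k.
rewrite -sum_value -sumEFin; apply: eq_bigr => k _.
by have [_ -> _] := XP k; rewrite -EFinM.
Qed.

(** The points whose average is [Z] are competitors in the maxima of (1). *)
Lemma barycenter_objective_le Y Z : convex_order_feasible nu lambda b Z ->
  (barycenter_objective nu lambda b Y <= (sqnormb b Y + C - 2 * dotb b Y Z)%:E)%E.
Proof.
move=> [X' [-> coX']]; rewrite -sum_value -sumEFin.
apply: lee_sum => k _; have [X [_ -> Xmax]] := W2_atomic b (nu k) b_sum (nu2 k) Y.
rewrite -EFinM lee_fin ler_pM2l// lerD2l lerN2 ler_pM2l//.
exact: Xmax.
Qed.

Lemma barycenter_minimizer Y :
  minimizer setT (barycenter_objective nu lambda b) Y <->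
  minimizer (convex_order_feasible nu lambda b) (fun Z => - (sqnormb b Z / 2)) Y.
Proof.
split=> [[_ Ymin]|[fY Ymin]].
  have [Z fZ YE] := barycenter_objective_attained Y.
  (* The objective at a feasible [Z'] is bounded by pairing [Z'] with itself, which gives C -
     |Z'|_b^2. *)
  have YZ Z' : convex_order_feasible nu lambda b Z' ->
      sqnormb b Y + C - 2 * dotb b Y Z <= C - sqnormb b Z'.
    move=> fZ'; rewrite -lee_fin -YE; apply: le_trans (Ymin Z' _) _ => //.
    apply: le_trans (barycenter_objective_le Z' Z' fZ') _.
    by rewrite lee_fin dotbb; lra.
  (* Taking [Z' = Z] gives |Y - Z|_b^2 <= 0. *)
  have Y_eq : Y = Z.
    apply/eqP; rewrite -subr_eq0; apply/eqP/(sqnormb_eq0 b).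
    by rewrite sqnormbB; have := YZ Z fZ; lra.
  split=> [|Z' /YZ]; first by rewrite Y_eq.
  by rewrite -Y_eq dotbb; lra.
(* The chain is: objective at [Y] <= C - |Y|_b^2 <= C - |Z|_b^2 <= C - |Z|_b^2 + |Y' - Z|_b^2 =
   objective at [Y']. *)
split=> // Y' _.
have [Z fZ ->] := barycenter_objective_attained Y'.
apply: le_trans (barycenter_objective_le Y Y fY) _; rewrite lee_fin dotbb.
have := Ymin Z fZ; have := sqnormb_ge0 b (Y' - Z); rewrite sqnormbB; lra.
Qed.

End barycenter.

Theorem proposition6p5 (R : realType) (d K M : nat)
    (nu : 'I_K -> probability (borel_rV R d) R) (hnu : forall k, P2 (nu k))
    (lambda : 'I_K -> R) (lambda_gt0 : forall k, 0 < lambda k)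
    (lambda_sum : \sum_(k < K) lambda k = 1)
    (b : 'I_M -> {posnum R}) (b_sum : \sum_(j < M) (b j)%:num = 1)
    (Y : 'M[R]_(M, d)) :
  minimizer setT (barycenter_objective nu lambda b) Y <->
  minimizer (convex_order_feasible nu lambda b)
    (fun Z : 'M[R]_(M, d) => - (sqnormb b Z / 2)) Y.
Proof.
(* The case of no atoms contradicts [b_sum]; otherwise [ord0] is available as an index. *)
case: M b b_sum Y => [b|M b b_sum Y]; last exact: barycenter_minimizer.
by rewrite big_ord0 => /eqP; rewrite eq_sym oner_eq0.
Qed.
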